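(* Let $R$ be a commutative unital ring (with $1_R \neq 0$) carrying the discrete topology, $G$ a small category, and $s : G \to \mathrm{Top}^{\mathrm{op}}$ a functor such that for each $e\in\mathrm{ob}(G)$ the space $s(e)$ carries the discrete topology. For each $e\in \mathrm{ob}(G)$ let $A_e$ be the ring of all functions $s(e)\to R$, put $A=\bigoplus_{e\in \mathrm{ob}(G)} A_e$, and let $A\rtimes^{\sigma}G$ be the associated skew category algebra. Consider the assertions: (i) $s$ is topologically free; (ii) if $I$ is a nonzero (two-sided) ideal of $A\rtimes^{\sigma}G$, then $I\cap A\neq\{0\}$; (iii) $A$ is maximal commutative in $A\rtimes^{\sigma}G$. Then: (a) (ii) implies (iii); (b) if $G$ is a groupoid, then (ii) holds if and only if (iii) holds; (c) if $R$ is an integral domain, then (i) holds if and only if (iii) holds; (d) if there are $e\in\mathrm{ob}(G)$ and $x\in s(e)$ such that the cardinality of $G_e$ is greater than the cardinality of $\mathrm{Orb}_e(x)$ and $G_e$ is a divisible monoid, then (iii) does not hold; (e) if there are $e\in\mathrm{ob}(G)$ and $x\in s(e)$ such that $\mathrm{Orb}_e(x)$ is finite and $G_e$ is an infinite and divisible monoid (e.g. $(\mathbb{Z},+)$ or $(\mathbb{N},+)$), then (iii) does not hold.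
   Context: For a morphism $n$ of $G$, $d(n)$ and $c(n)$ denote its domain and codomain; objects are identified with their identity morphisms; $mn$ is defined when $d(m)=c(n)$. $G_e$ is the monoid of all morphisms $e\to e$. $\mathrm{Top}$ is the category of topological spaces and continuous maps. A functor $s : G \to \mathrm{Top}^{\mathrm{op}}$ assigns to each object $e$ a space $s(e)$ and to each morphism $n$ a continuous map $s(n) : s(c(n)) \to s(d(n))$, with $s(mn) = s(n)\circ s(m)$ and $s(e)=\mathrm{id}_{s(e)}$ for identities. For $x\in s(e)$, $\mathrm{Orb}_e(x)=\{s(n)(x) : n\in G_e\}$. Here $G_e$ is called divisible if for any distinct $m,n\in G_e$ there is $p\in G_e$ with $m=np$ or $n=mp$. Topologically free: $x \in s(e)$ is periodic if there is a nonidentity morphism $n : e \to e$ with $s(n)(x)=x$, and aperiodic otherwise; $s$ is topologically free if for every $e\in\mathrm{ob}(G)$ the set of aperiodic elements of $s(e)$ is dense in $s(e)$. For a morphism $n$, $\sigma(n): A_{d(n)} \to A_{c(n)}$ is given by $\sigma(n)(f)=f\circ s(n)$. The skew category algebra $A \rtimes^{\sigma} G$ is the set of formal sums $\sum_{n\in G} a_n u_n$ over morphisms $n$ of $G$, with $a_n \in A_{c(n)}$ and $a_n = 0$ for all but finitely many $n$, with componentwise addition and multiplication $$\Big(\sum_{n} a_n u_n\Big)\Big(\sum_{n} b_n u_n\Big) = \sum_{n} \Big(\sum_{mm'=n,\ d(m)=c(m')} a_m\,\sigma(m)(b_{m'})\Big) u_n .$$ $A$ is regarded as a subring via $\sum_e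 a_e \mapsto \sum_{e} a_e u_e$. A commutative subring is maximal commutative if it equals its commutant (the set of elements of the big ring commuting with all its elements). *)

(* Defs.v *)
From HB Require Import structures.
From mathcomp Require Import all_boot all_order all_algebra.
From mathcomp Require Import all_classical topology.

Set Implicit Arguments.
Unset Strict Implicit.
Unset Printing Implicit Defensive.

Import Order.TTheory GRing.Theory.
Local Open Scope classical_set_scope.
Local Open Scope ring_scope.

(* [mcomp m n] is the composite "mn" (first n, then m). *)
Record category := Category {
  ob :> Type;
  mhom : ob -> ob -> Type;
  mid : forall e, mhom e e;
  mcomp : forall d e c, mhom e c -> mhom d e -> mhom d c;
  mcomp1m : forall d c (n : mhom d c), mcomp (mid c) n = n;
  mcompm1 : forall d c (n : mhom d c), mcomp n (mid d) = n;
  mcompA : forall b d e c (l : mhom e c) (m : mhom d e) (n : mhom b d),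
    mcomp l (mcomp m n) = mcomp (mcomp l m) n
}.
Arguments mid {_} _.
Arguments mcomp {_ _ _ _} _ _.

Record mor (G : category) := Mor { dom : G; cod : G; arr : mhom dom cod }.
Arguments Mor {G dom cod} _.

Definition groupoid (G : category) : Prop :=
  forall (d c : G) (n : mhom d c),
    exists m : mhom c d, mcomp m n = mid d /\ mcomp n m = mid c.

Definition divisible_at (G : category) (e : G) : Prop :=
  forall m n : mhom e e, m <> n ->
    exists p : mhom e e, m = mcomp n p \/ n = mcomp m p.

(* A functor from G to the opposite of the category of topological spaces.
   The spaces may be empty. *)
Record top_functor (G : category) := TopFunctor {
  space :> G -> topologicalType;
  act : forall d c : G, mhom d c -> space c -> space d;
  act_continuous : forall (d c : G) (n : mhom d c), continuous (act n);
  act_id : forall e : G, act (mid e) = id;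
  act_comp : forall (d e c : G) (m : mhom e c) (n : mhom d e),
    act (mcomp m n) = act n \o act m
}.
Arguments act {G} s {d c} n x : rename.

Definition orbit_at (G : category) (s : top_functor G) (e : G) (x : s e) :
    set (s e) :=
  range (fun n : mhom e e => act s n x).

Definition periodic (G : category) (s : top_functor G) (e : G) (x : s e) : Prop :=
  exists2 n : mhom e e, n <> mid e & act s n x = x.

Definition topologically_free (G : category) (s : top_functor G) : Prop :=
  forall e : G, dense [set x : s e | ~ periodic x].

Definition card_lt (T U : Type) (X : set T) (Y : set U) : Prop :=
  (X #<= Y)%card /\ ~ (Y #<= X)%card.

Section SkewCategoryAlgebra.
Variables (R : comNzRingType) (G : category) (s : top_functor G).

(* The ring A_e is the type [s e -> R] with its pointwise ring structure. *)
Definition sigma (d c : G) (n : mhom d c) (f : s d -> R) : s c -> R :=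
  f \o act s n.

(* The formal sum of the a_n u_n is encoded by its family of coefficients
   a_n in A_(cod n). *)
Record skew_alg := SkewAlg {
  coef : forall n : mor G, s (cod n) -> R;
  coef_fin : finite_set [set n | @coef n <> 0]
}.
Arguments coef : clear implicits.

HB.instance Definition _ := gen_eqMixin skew_alg.
HB.instance Definition _ := gen_choiceMixin skew_alg.

Lemma skew_algP (a b : skew_alg) :
  (forall n, coef a n = coef b n) -> a = b.
Proof.
case: a b => [a fa] [b fb] /= ab.
have {}ab : a = b by apply: functional_extensionality_dep.
by rewrite ab in fa *; congr SkewAlg; exact: Prop_irrelevance.
Qed.

Lemma skew_zero_fin : finite_set [set n : mor G | (0 : s (cod n) -> R) <> 0].
Proof. by apply: (sub_finite_set _ (@finite_set0 _)) => n /=; apply. Qed.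
Definition skew_zero := SkewAlg skew_zero_fin.

Lemma skew_opp_fin (a : skew_alg) : finite_set [set n | - coef a n <> 0].
Proof.
apply: sub_finite_set (coef_fin a) => n /= h h0.
by apply: h; rewrite h0 oppr0.
Qed.
Definition skew_opp a := SkewAlg (skew_opp_fin a).

Lemma skew_add_fin (a b : skew_alg) :
  finite_set [set n | coef a n + coef b n <> 0].
Proof.
apply: (@sub_finite_set _ _ ([set n | coef a n <> 0] `|` [set n | coef b n <> 0])).
  move=> n /= h; apply/not_andP => -[a0 b0].
  by apply: h; rewrite a0 b0 addr0.
by rewrite finite_setU; split; exact: coef_fin.
Qed.
Definition skew_add a b := SkewAlg (skew_add_fin a b).

Lemma skew_addA : associative skew_add.
Proof. by move=> a b c; apply: skew_algP => n; exact: addrA. Qed.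
Lemma skew_addC : commutative skew_add.
Proof. by move=> a b; apply: skew_algP => n; exact: addrC. Qed.
Lemma skew_add0 : left_id skew_zero skew_add.
Proof. by move=> a; apply: skew_algP => n; exact: add0r. Qed.
Lemma skew_addN : left_inverse skew_zero skew_opp skew_add.
Proof. by move=> a; apply: skew_algP => n; exact: addNr. Qed.

HB.instance Definition _ := GRing.isZmodule.Build skew_alg
  skew_addA skew_addC skew_add0 skew_addN.

(* [factors d c] is the type of composable pairs (m, m') with mm' : d -> c;
   the component [tag] is the common object d(m) = c(m'). *)
Definition factors (d c : G) := {e : G & (mhom e c * mhom d e)%type}.
Definition fact1 d c (p : factors d c) : mhom (tag p) c := (tagged p).1.
Definition fact2 d c (p : factors d c) : mhom d (tag p) := (tagged p).2.

(* The sum has finite support, by [skew_mul_supp] below. *)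
Definition skew_mul_coef (a b : skew_alg) (n : mor G) : s (cod n) -> R :=
  \sum_(p \in [set p : {classic factors (dom n) (cod n)} |
                 mcomp (fact1 p) (fact2 p) = arr n])
     (coef a (Mor (fact1 p)) * sigma (fact1 p) (coef b (Mor (fact2 p)))
       : s (cod n) -> R).

Lemma Mor_inj (d c : G) (m n : mhom d c) : Mor m = Mor n -> m = n.
Proof.
have gen q (E1 : d = dom q) (E2 : c = cod q) : Mor m = q ->
    ecast d (mhom d _) E1 (ecast c (mhom _ c) E2 m) = arr q.
  move=> mq; case: _ / mq E1 E2 => E1 E2.
  by rewrite (Prop_irrelevance E1 erefl) (Prop_irrelevance E2 erefl).
by move=> /(gen (Mor n) erefl erefl).
Qed.

Lemma skew_mul_supp (a b : skew_alg) (n : mor G) :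
  finite_set [set p : factors (dom n) (cod n) |
    coef a (Mor (fact1 p)) * sigma (fact1 p) (coef b (Mor (fact2 p))) <> 0].
Proof.
pose h (p : factors (dom n) (cod n)) := (Mor (fact1 p), Mor (fact2 p)).
have h_inj : injective h.
  move=> [e [m m']] [e1 [m1 m1']] E.
  have E1 : Mor m = Mor m1 := congr1 fst E.
  have E2 : Mor m' = Mor m1' := congr1 snd E.
  have Ee : e = e1 := congr1 (@dom G) E1.
  clear E.
  case: _ / Ee m1 m1' E1 E2 => m1 m1' E1 E2.
  by rewrite (Mor_inj E1) (Mor_inj E2).
have hfin : finite_set (h @^-1` ([set m | coef a m <> 0] `*` [set m | coef b m <> 0])).
  apply: finite_preimage; first by move=> p q _ _; exact: h_inj.
  by apply: finite_setX; exact: coef_fin.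
apply: sub_finite_set hfin => p /= p0; split=> /= q0; apply: p0.
  by rewrite q0 mul0r.
by rewrite q0 [sigma _ _](_ : _ = 0) ?mulr0.
Qed.

Definition mor_comp (p q : mor G) : mor G :=
  match pselect (cod q = dom p) with
  | left E => Mor (mcomp (arr p) (ecast e (mhom (dom q) e) E (arr q)))
  | right _ => p
  end.

Lemma mor_compE (d e c : G) (m : mhom e c) (m' : mhom d e) :
  mor_comp (Mor m) (Mor m') = Mor (mcomp m m').
Proof.
rewrite /mor_comp /=; case: pselect => // E.
by rewrite (Prop_irrelevance E erefl).
Qed.

Lemma skew_mul_fin (a b : skew_alg) :
  finite_set [set n | @skew_mul_coef a b n <> 0].
Proof.
apply: sub_finite_set
  (finite_image2 mor_comp (coef_fin a) (coef_fin b)) => n /= n0.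
apply: contrapT => nex; apply: n0; apply: fsbig1 => p /= pn.
have [a0|a0] := pselect (coef a (Mor (fact1 p)) = 0).
  by rewrite a0 mul0r.
have [b0|b0] := pselect (coef b (Mor (fact2 p)) = 0).
  by rewrite b0 [sigma _ _](_ : _ = 0) ?mulr0.
exfalso; apply: nex; exists (Mor (fact1 p)) => //.
exists (Mor (fact2 p)) => //.
by rewrite mor_compE pn; case: (n).
Qed.
Definition skew_mul a b := SkewAlg (skew_mul_fin a b).

(* Elements of the direct sum A of the rings A_e. *)
Record dsum := DSum {
  comps : forall e : G, s e -> R;
  comps_fin : finite_set [set e | @comps e <> 0]
}.
Arguments comps : clear implicits.

(* The sum of the a_e maps to the sum of the a_e u_e. *)
Definition embed_coef (a : dsum) (n : mor G) : s (cod n) -> R :=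
  if pselect (n = Mor (mid (cod n))) then comps a (cod n) else 0.

Lemma embed_fin (a : dsum) : finite_set [set n | @embed_coef a n <> 0].
Proof.
apply: sub_finite_set
  (finite_image (fun e => Mor (mid e)) (comps_fin a)) => n /=.
by rewrite /embed_coef; case: pselect => //= nE a0; exists (cod n).
Qed.
Definition embed a := SkewAlg (embed_fin a).

Definition diag_alg : set skew_alg := range embed.

(* The skew category algebra has no unit in general (infinitely many objects),
   so ideals are required to be additive subgroups explicitly. *)
Definition ideal (I : set skew_alg) : Prop :=
  [/\ I 0,
      forall a b, I a -> I b -> I (a - b)
    & forall a b, I b -> I (skew_mul a b) /\ I (skew_mul b a)].

Definition ideal_intersection (S : set skew_alg) : Prop :=
  forall I : set skew_alg, ideal I -> I <> [set 0] -> I `&` S <> [set 0].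

Definition commutant (S : set skew_alg) : set skew_alg :=
  [set x | forall y, S y -> skew_mul x y = skew_mul y x].

Definition maximal_commutative (S : set skew_alg) : Prop := S = commutant S.

End SkewCategoryAlgebra.
Arguments coef {R G s} a n _ : rename.
Arguments comps {R G s} a e _ : rename.
Arguments diag_alg R {G} s _.

(* Main.v *)
Require Import Defs.
From HB Require Import structures.
From mathcomp Require Import all_boot all_order all_algebra finmap.
From mathcomp Require Import all_classical topology.

(** Comparing coefficients in [f a = a f], for [f] ranging over the indicators of
    points, shows that the commutant of [A] consists of the sums of [a_n u_n]
    over endomorphisms [n] with [a_n] supported on the fixed points of [s(n)].
    Hence (iii) holds iff there are no periodic points, which on discrete spaces
    is (i); the pigeonhole principle and divisibility then give (d) and (e).

    For (a), the algebra acts on families [phi] of functions [s(e) -> R] by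
    [(a phi)_c (y) = \sum_(n : d -> c) a_n(y) phi_d (s(n) y)].
    The annihilator of this module is an ideal which meets [A] trivially, and it
    contains [delta_x u_n - delta_x u_e] as soon as [s(n) x = x].

    For (b), if [a_n(x) <> 0] and there are no periodic points, then
    [delta_x a (delta_(s(n) x) u_(n^-1)) = a_n(x) delta_x u_c], an element of
    [A]. *)

Set Implicit Arguments.
Unset Strict Implicit.
Unset Printing Implicit Defensive.

Import GRing.Theory.
Local Open Scope classical_set_scope.
Local Open Scope ring_scope.

(** * Dependent pairs and finitely supported sums *)

(** Generalizing the right-hand pair to [q] leaves a transport along a proof of [t = t], which proof
    irrelevance makes trivial. *)
Lemma existT_inj (T : Type) (P : T -> Type) (t : T) (u v : P t) :
  existT P t u = existT P t v -> u = v.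
Proof.
have gen q (E : t = tag q) : existT P t u = q -> ecast t (P t) E u = tagged q.
  by move=> uq; case: _ / uq E => E; rewrite (Prop_irrelevance E erefl).
by move=> /(gen (existT P t v) erefl).
Qed.

(** A sum with infinite support is 0 by convention, and a family of functions can have infinite
    support while its values at each point do not; finiteness makes both sides sums over the same
    finite set. *)
Lemma fsum_apply (I : choiceType) (T : Type) (V : nmodType) (P : set I)
    (F : I -> T -> V) (y : T) :
  finite_set [set i | F i <> 0] ->
  (\sum_(i \in P) F i) y = \sum_(i \in P) F i y.
Proof.
move=> Ffin; have PFfin : finite_set (P `&` [set i | F i <> 0]).
  exact: finite_setIr.
have F0 i : P i -> i \notin fset_set (P `&` [set i | F i <> 0]) -> F i = 0.
  move=> Pi; rewrite in_fset_set// notin_setE => Fi.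
  by apply: contrapT => Fi0; apply: Fi.
have sub : [set` fset_set (P `&` [set i | F i <> 0])] `<=` P.
  by move=> i; rewrite /= in_fset_set// inE => -[].
rewrite (fsbigE (fset_set (P `&` [set i | F i <> 0])))// fct_sumE.
rewrite [RHS](fsbigE (fset_set (P `&` [set i | F i <> 0])))//.
by move=> i Pi /(F0 _ Pi) ->.
Qed.

(** On the finite support of [F] this is a partition of a finite sum; it regroups the double sums in
    the module law below. *)
Lemma fsum_fibers (I J : choiceType) (V : nmodType) (h : I -> J) (F : I -> V) :
  finite_set [set i | F i <> 0] ->
  \sum_(j \in [set: J]) \sum_(i \in h @^-1` [set j]) F i =
  \sum_(i \in [set: I]) F i.
Proof.
move=> Ffin; set A := fset_set [set i | F i <> 0].
have F0 i : i \notin A -> F i = 0.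
  by rewrite in_fset_set// notin_setE => /contrapT.
have fiber j : \sum_(i \in h @^-1` [set j]) F i = \sum_(i <- A | h i == j) F i.
  rewrite [RHS]bigfs//; last by move=> i _; exact: F0.
  by apply: eq_fsbigl; apply/seteqP; split=> i /= /eqP.
under eq_fsbigr do rewrite fiber.
rewrite [RHS](fsbigTE A)// (partition_big_imfset _ h).
rewrite (fsbigTE [fset h x | x in A]%fset)// => j jA.
rewrite big_seq_cond big1// => i /andP[iA /eqP hij].
by move: jA; rewrite -hij in_imfset.
Qed.

Lemma mulr_fsumr_fin (I : choiceType) (R : pzRingType) (x : R) (P : set I)
    (F : I -> R) :
  finite_set [set i | F i <> 0] ->
  x * (\sum_(i \in P) F i) = \sum_(i \in P) x * F i.
Proof.
by move=> Ffin; apply: full_fsbig_distrr; exact: finite_setIr.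
Qed.

(** * Coefficients of products, in particular with elements of A *)

Lemma skew_mulE (R : comNzRingType) (G : category) (s : top_functor G)
    (a b : skew_alg R s) (d c : G) (n : mhom d c) (y : s c) :
  coef (skew_mul a b) (Mor n) y =
  \sum_(p \in [set p : {classic factors d c} |
                 mcomp (fact1 p) (fact2 p) = n])
     coef a (Mor (fact1 p)) y * coef b (Mor (fact2 p)) (act s (fact1 p) y).
Proof.
rewrite /= /skew_mul_coef fsum_apply//.
exact: (@skew_mul_supp _ _ _ a b (Mor n)).
Qed.

Lemma mulr_fsuml_fin (I : choiceType) (R : comPzRingType) (x : R) (P : set I)
    (F : I -> R) :
  finite_set [set i | F i <> 0] ->
  (\sum_(i \in P) F i) * x = \sum_(i \in P) F i * x.
Proof.
move=> Ffin; rewrite mulrC mulr_fsumr_fin//.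
by apply: eq_fsbigr => i _; rewrite mulrC.
Qed.

Lemma fsum_eq1 (I : choiceType) (V : nmodType) (P : set I) (F : I -> V) (i : I) :
  P i -> (forall j, P j -> F j <> 0 -> j = i) -> \sum_(j \in P) F j = F i.
Proof.
move=> Pi Fi; transitivity (\sum_(j \in [set i]) F j); last exact: fsbig_set1.
apply/esym/fsbig_widen.
  by move=> j ->.
by move=> j [Pj ji]; apply: contrapT => /(Fi _ Pj).
Qed.

Lemma embed_mid (R : comNzRingType) (G : category) (s : top_functor G)
    (f : dsum R s) (n : mor G) :
  n = Mor (mid (cod n)) -> coef (embed f) n = comps f (cod n).
Proof. by rewrite /= /embed_coef; case: pselect. Qed.

Lemma embed_notmid (R : comNzRingType) (G : category) (s : top_functor G)
    (f : dsum R s) (n : mor G) :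
  n <> Mor (mid (cod n)) -> coef (embed f) n = 0.
Proof. by rewrite /= /embed_coef; case: pselect. Qed.

(** Since [embed f] is supported on identities, the only factorization of [n] that can contribute is
    the one through [mid c]. *)
Lemma skew_mul_embedl (R : comNzRingType) (G : category) (s : top_functor G)
    (f : dsum R s) (a : skew_alg R s) (n : mor G) (y : s (cod n)) :
  coef (skew_mul (embed f) a) n y = comps f (cod n) y * coef a n y.
Proof.
case: n y => d c n y.
pose p0 : {classic factors d c} := existT _ c (mid c, n).
rewrite skew_mulE (fsum_eq1 (i := p0)).
- transitivity (coef (embed f) (Mor (mid c)) y *
                coef a (Mor n) (act s (mid c) y)).
    by [].
  by rewrite embed_mid// act_id.
- exact: mcomp1m.
- case=> [e [m m']] mm' h; have {}mm' : mcomp m m' = n := mm'.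
  have {}h : coef (embed f) (Mor m) y * coef a (Mor m') (act s m y) <> 0 := h.
  have E : Mor m = Mor (mid c).
    by apply: contrapT => m1; apply: h; rewrite embed_notmid ?mul0r.
  have Ee : e = c := congr1 (@dom G) E.
  case: _ / (esym Ee) m m' E mm' {h} => m m' /Mor_inj-> mm'.
  by rewrite /p0 -mm' mcomp1m.
Qed.

Lemma skew_mul_embedr (R : comNzRingType) (G : category) (s : top_functor G)
    (f : dsum R s) (a : skew_alg R s) (n : mor G) (y : s (cod n)) :
  coef (skew_mul a (embed f)) n y =
  coef a n y * comps f (dom n) (act s (arr n) y).
Proof.
case: n y => d c n y.
pose p0 : {classic factors d c} := existT _ d (n, mid d).
rewrite skew_mulE (fsum_eq1 (i := p0)).
- transitivity (coef a (Mor n) y * coef (embed f) (Mor (mid d)) (act s n y)).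
    by [].
  by rewrite embed_mid.
- exact: mcompm1.
- case=> [e [m m']] mm' h; have {}mm' : mcomp m m' = n := mm'.
  have {}h : coef a (Mor m) y * coef (embed f) (Mor m') (act s m y) <> 0 := h.
  have E : Mor m' = Mor (mid e).
    by apply: contrapT => m1; apply: h; rewrite embed_notmid ?mulr0.
  have Ee : d = e := congr1 (@dom G) E.
  case: _ / Ee m m' E mm' {h} => m m' /Mor_inj-> mm'.
  by rewrite /p0 -mm' mcompm1.
Qed.

Lemma diag_algP (R : comNzRingType) (G : category) (s : top_functor G)
    (a : skew_alg R s) :
  (forall (n : mor G) y, coef a n y <> 0 -> n = Mor (mid (cod n))) ->
  diag_alg R s a.
Proof.
move=> a_mid.
have fin : finite_set [set e | coef a (Mor (mid e)) <> 0].
  apply: sub_finite_set (finite_image (@cod G) (coef_fin a)) => e h.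
  by exists (Mor (mid e)).
exists (DSum fin) => //; apply: skew_algP => n.
have [nE|nE] := pselect (n = Mor (mid (cod n))).
  by rewrite nE embed_mid.
rewrite embed_notmid//; apply/esym/funext => y; apply: contrapT => /a_mid.
exact: nE.
Qed.

(** * Indicators of points and monomials *)

Lemma delta_fin (R : comNzRingType) (G : category) (s : top_functor G)
    (e : G) (x : s e) :
  finite_set [set e' | (fun y : s e' =>
    (`[< existT (fun c => s c : Type) e' y =
         existT (fun c => s c : Type) e x >]%:R : R)) <> (0 : s e' -> R)].
Proof.
apply: (@sub_finite_set _ _ [set e]); last exact: finite_set1.
move=> e' /= h; apply: contrapT => ee'; apply: h; apply/funext => y.
by case: asboolP => // /(congr1 (@tag _ _)).
Qed.
Definition delta (R : comNzRingType) (G : category) (s : top_functor G)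
  (e : G) (x : s e) : dsum R s := DSum (delta_fin R x).

(* [monomial n x] is delta_x u_n; comparing dependent pairs avoids transporting
   [x] along an equality of morphisms. *)
Lemma monomial_fin (R : comNzRingType) (G : category) (s : top_functor G)
    (n : mor G) (x : s (cod n)) :
  finite_set [set n' | (fun y : s (cod n') =>
    (`[< existT (fun q => s (cod q) : Type) n' y =
         existT (fun q => s (cod q) : Type) n x >]%:R : R))
      <> (0 : s (cod n') -> R)].
Proof.
apply: (@sub_finite_set _ _ [set n]); last exact: finite_set1.
move=> n' /= h; apply: contrapT => nn'; apply: h; apply/funext => y.
by case: asboolP => // /(congr1 (@tag _ _)).
Qed.
Definition monomial (R : comNzRingType) (G : category) (s : top_functor G)
  (n : mor G) (x : s (cod n)) : skew_alg R s := SkewAlg (monomial_fin R x).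

Lemma monomial_id (R : comNzRingType) (G : category) (s : top_functor G)
    (n : mor G) (x : s (cod n)) :
  coef (monomial R x) n x = 1.
Proof. by rewrite /=; case: asboolP. Qed.

Lemma monomial_neq0 (R : comNzRingType) (G : category) (s : top_functor G)
    (n m : mor G) (x : s (cod n)) (y : s (cod m)) :
  coef (monomial R x) m y <> 0 ->
  existT (fun q => s (cod q) : Type) m y =
  existT (fun q => s (cod q) : Type) n x.
Proof. by rewrite /=; case: asboolP. Qed.

(** * The commutant of A and periodic points *)

Lemma maximal_commutativeP (R : comNzRingType) (G : category)
    (s : top_functor G) :
  maximal_commutative (diag_alg R s) <->
  (forall (e : G) (x : s e), ~ periodic x).
Proof.
split=> [maxA e x [n n1 nx]|free].
(* delta_x u_n commutes with A because s(n) fixes x, yet it lies outside A because [n] is not an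
   identity. *)
- have : commutant (diag_alg R s) (monomial R (x : s (cod (Mor n)))).
    move=> _ [f _ <-]; apply: skew_algP => m; apply/funext => y.
    rewrite skew_mul_embedl skew_mul_embedr [RHS]mulrC.
    have [->|/monomial_neq0 E] :=
      pselect (coef (monomial R (x : s (cod (Mor n)))) m y = 0).
      by rewrite !mul0r.
    have Em : Mor n = m := esym (congr1 (@tag _ _) E).
    subst m; have -> : y = x := existT_inj E.
    by rewrite nx.
  rewrite -maxA => -[f _ fE].
  have := monomial_id R (x : s (cod (Mor n))).
  rewrite -fE embed_notmid => [|/Mor_inj//].
  by move/esym/eqP; rewrite oner_eq0.
- apply/seteqP; split=> [_ [f _ <-] _ [g _ <-]|a a_comm].
    apply: skew_algP => n; apply/funext => y.
    rewrite !skew_mul_embedl.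
    have [nE|nE] := pselect (n = Mor (mid (cod n))).
      by rewrite !embed_mid// mulrC.
    by rewrite !embed_notmid// !mulr0.
  apply: diag_algP => -[d c n] /= y any0.
  (* Commuting with delta_y gives a_n(y) delta_y(s(n) y) = a_n(y) at [y], so a nonzero a_n(y) forces
     [d = c] and s(n) y = y. *)
  have := a_comm _ (ex_intro2 _ _ (delta R y) I erefl).
  move=> /(congr1 (fun b => coef b (Mor n) y)).
  rewrite skew_mul_embedl skew_mul_embedr /=.
  case: asboolP => [E _|_]; last first.
    by rewrite mulr0; case: asboolP => //= _; rewrite mul1r => /esym.
  have Ed : d = c := congr1 (@tag _ _) E.
  case: _ / (esym Ed) n any0 E => n any0 E.
  have ny : act s n y = y := existT_inj E.
  apply: contrapT => n1; apply: (free _ y).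
  by exists n => // nE; apply: n1; rewrite nE.
Qed.

(** * A module over the skew category algebra *)

Definition module_act (R : comNzRingType) (G : category) (s : top_functor G)
    (a : skew_alg R s) (phi : forall e : G, s e -> R) (c : G) (y : s c) : R :=
  \sum_(p \in [set: {classic {d : G & mhom d c}}])
     coef a (Mor (tagged p)) y * phi (tag p) (act s (tagged p) y).

Lemma coef_tagged_fin (R : comNzRingType) (G : category) (s : top_functor G)
    (a : skew_alg R s) (c : G) :
  finite_set [set p : {d : G & mhom d c} | coef a (Mor (tagged p)) <> 0].
Proof.
pose h (p : {d : G & mhom d c}) := Mor (tagged p).
apply: (finite_preimage (f := h)) (coef_fin a).
move=> [d m] [d' m'] _ _ E.
have {}E : Mor m = Mor m' := E.
have Ed : d = d' := congr1 (@dom G) E.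
by case: _ / Ed m' E => m' /Mor_inj ->.
Qed.

Lemma module_actB (R : comNzRingType) (G : category) (s : top_functor G)
    (a b : skew_alg R s) (phi : forall e : G, s e -> R) (c : G) (y : s c) :
  module_act (a - b) phi y = module_act a phi y - module_act b phi y.
Proof.
(* The supports of [a], [b] and [a - b] may differ, so all three sums are first taken over one
   finite set containing them. *)
pose D : set {classic {d : G & mhom d c}} :=
  [set p : {d : G & mhom d c} | coef a (Mor (tagged p)) <> 0] `|`
  [set p : {d : G & mhom d c} | coef b (Mor (tagged p)) <> 0].
have Dfin : finite_set D by rewrite finite_setU; split; exact: coef_tagged_fin.
have toD (e : skew_alg R s) :
    (forall p, ~ D p -> coef e (Mor (tagged p)) = 0) ->
    module_act e phi y = \sum_(p <- fset_set D)
      coef e (Mor (tagged p)) y * phi (tag p) (act s (tagged p) y).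
  move=> De; apply: fsbigTE => p; rewrite in_fset_set// notin_setE => /De ->.
  by rewrite mul0r.
have aD p : ~ D p -> coef a (Mor (tagged p)) = 0.
  by move=> /not_orP[/contrapT].
have bD p : ~ D p -> coef b (Mor (tagged p)) = 0.
  by move=> /not_orP[_ /contrapT].
rewrite !toD// => [|p Dp]; last first.
  have -> : coef (a - b) (Mor (tagged p)) =
    coef a (Mor (tagged p)) - coef b (Mor (tagged p)) by [].
  by rewrite aD ?bD ?subr0.
by rewrite -sumrB; apply: eq_bigr => p _; rewrite -mulrBl.
Qed.

(** Both sides equal the sum of [F] over all composable pairs ending at [c]: grouping by the
    composite ([h2]) gives the left side, grouping by the outer factor ([h1]) the right side. *)
Lemma module_actM (R : comNzRingType) (G : category) (s : top_functor G)
    (a b : skew_alg R s) (phi : forall e : G, s e -> R) (c : G) (y : s c) :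
  module_act (skew_mul a b) phi y = module_act a (module_act b phi) y.
Proof.
pose T := {classic {e : G & (mhom e c * {d : G & mhom d e})%type}}.
pose F (t : T) : R :=
  coef a (Mor (tagged t).1) y *
  (coef b (Mor (tagged (tagged t).2)) (act s (tagged t).1 y) *
   phi (tag (tagged t).2)
     (act s (tagged (tagged t).2) (act s (tagged t).1 y))).
have Ffin : finite_set [set t | F t <> 0].
  pose h (t : T) := (Mor (tagged t).1, Mor (tagged (tagged t).2)).
  have h_inj : injective h.
    move=> [e [m [d m']]] [e1 [m1 [d1 m1']]] E.
    have E1 : Mor m = Mor m1 := congr1 fst E.
    have E2 : Mor m' = Mor m1' := congr1 snd E.
    clear E.
    have Ee : e = e1 := congr1 (@dom G) E1.
    have Ed : d = d1 := congr1 (@dom G) E2.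
    case: _ / Ee m1 m1' E1 E2 => m1 m1' /Mor_inj -> E2.
    by case: _ / Ed m1' E2 => m1' /Mor_inj ->.
  have hfin : finite_set
      (h @^-1` ([set m | coef a m <> 0] `*` [set m | coef b m <> 0])).
    apply: finite_preimage; first by move=> p q _ _; exact: h_inj.
    by apply: finite_setX; exact: coef_fin.
  apply: sub_finite_set hfin => t /= t0; split=> /= q0; apply: t0.
    by rewrite /F q0 mul0r.
  by rewrite /F q0 mul0r mulr0.
have b_fin := coef_tagged_fin b.
pose h1 (t : T) : {classic {e : G & mhom e c}} := existT _ (tag t) (tagged t).1.
pose h2 (t : T) : {classic {d : G & mhom d c}} :=
  existT _ (tag (tagged t).2) (mcomp (tagged t).1 (tagged (tagged t).2)).
transitivity (\sum_(t \in [set: T]) F t).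
- rewrite -(fsum_fibers h2 Ffin); apply: eq_fsbigr => -[d n] _.
  rewrite skew_mulE mulr_fsuml_fin; last first.
    apply: sub_finite_set (skew_mul_supp a b (Mor n)) => p /= p0 q0.
    by apply: p0; exact: (congr1 (@^~ y) q0).
  (* Factorizations of [n] correspond bijectively to the fiber of [h2] over [n]. *)
  pose h (p : {classic factors d c}) : T :=
    existT _ (tag p) (fact1 p, existT _ d (fact2 p)).
  rewrite (reindex_fsbig h [set p | mcomp (fact1 p) (fact2 p) = n]).
    apply: eq_fsbigr => -[e [m m']] /set_mem/= <-.
    by rewrite /F /= /fact1 /fact2 /= act_comp mulrA.
  split.
  + by move=> [e [m m']] /= <-.
  + move=> [e [m m']] [e1 [m1 m1']] _ _ E.
    have Ee : e = e1 := congr1 (@tag _ _) E.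
    case: _ / Ee m1 m1' E => m1 m1' E.
    have -> : m = m1 := congr1 fst (existT_inj E).
    by have -> : m' = m1' := existT_inj (congr1 snd (existT_inj E)).
  + move=> [e [m [d' m']]] /= E.
    have Ed : d' = d := congr1 (@tag _ _) E.
    case: _ / (esym Ed) m' E => m' E.
    exists (existT _ e (m, m')) => //.
    exact: (existT_inj E).
- rewrite -(fsum_fibers h1 Ffin); apply: eq_fsbigr => -[e m] _.
  rewrite /= mulr_fsumr_fin; last first.
    apply: sub_finite_set (b_fin e) => p /= p0 q0; apply: p0.
    by rewrite q0 mul0r.
  pose h (p : {classic {d : G & mhom d e}}) : T := existT _ e (m, p).
  apply: (reindex_fsbig h [set: _]).
  split=> //.
  + by move=> p q _ _ E; exact: (congr1 snd (existT_inj E)).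
  + move=> [e' [m' p]] /= E.
    have Ee : e' = e := congr1 (@tag _ _) E.
    case: _ / (esym Ee) m' p E => m' p E.
    by have -> : m' = m := existT_inj E; exists p.
Qed.

Lemma module_act_embed (R : comNzRingType) (G : category) (s : top_functor G)
    (f : dsum R s) (phi : forall e : G, s e -> R) (c : G) (y : s c) :
  module_act (embed f) phi y = comps f c y * phi c y.
Proof.
pose p0 : {classic {d : G & mhom d c}} := existT (fun d => mhom d c) c (mid c).
rewrite /module_act (fsum_eq1 (i := p0))//.
- transitivity (coef (embed f) (Mor (mid c)) y * phi c (act s (mid c) y)).
    by [].
  by rewrite embed_mid// act_id.
- case=> [d n] _ h.
  have {}h : coef (embed f) (Mor n) y * phi d (act s n y) <> 0 := h.
  have E : Mor n = Mor (mid c).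
    by apply: contrapT => n1; apply: h; rewrite embed_notmid ?mul0r.
  have Ed : d = c := congr1 (@dom G) E.
  by case: _ / (esym Ed) n E {h} => n /Mor_inj->.
Qed.

Lemma module_act_monomial (R : comNzRingType) (G : category)
    (s : top_functor G) (d c : G) (n : mhom d c) (x : s c)
    (phi : forall e : G, s e -> R) :
  module_act (monomial R (x : s (cod (Mor n)))) phi x = phi d (act s n x).
Proof.
pose p0 : {classic {d : G & mhom d c}} := existT (fun d => mhom d c) d n.
rewrite /module_act (fsum_eq1 (i := p0))//.
- transitivity (coef (monomial R (x : s (cod (Mor n)))) (Mor n) x *
                phi d (act s n x)).
    by [].
  by rewrite monomial_id mul1r.
- case=> [d' n'] _ h.
  have {}h : coef (monomial R (x : s (cod (Mor n)))) (Mor n') x *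
    phi d' (act s n' x) <> 0 := h.
  have E : Mor n' = Mor n.
    apply: contrapT => n1; apply: h; rewrite [coef _ _ _](_ : _ = 0) ?mul0r//.
    by apply: contrapT => /monomial_neq0 /(congr1 (@tag _ _)).
  have Ed : d' = d := congr1 (@dom G) E.
  by case: _ / (esym Ed) n' E {h} => n' /Mor_inj->.
Qed.

Lemma module_act_monomial0 (R : comNzRingType) (G : category)
    (s : top_functor G) (n : mor G) (x : s (cod n))
    (phi : forall e : G, s e -> R) (c : G) (y : s c) :
  existT (fun e => s e : Type) c y <> existT (fun e => s e : Type) (cod n) x ->
  module_act (monomial R x) phi y = 0.
Proof.
move=> yx; apply: fsbig1 => -[d m] _.
transitivity (coef (monomial R x) (Mor m) y * phi d (act s m y)); first by [].
rewrite [coef _ _ _](_ : _ = 0) ?mul0r//.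
apply: contrapT => /monomial_neq0 E; apply: yx.
exact: (congr1 (fun q : {q & s (cod q) : Type} =>
  existT (fun e => s e : Type) (cod (tag q)) (tagged q)) E).
Qed.

(** * The annihilator ideal and aperiodicity *)

Definition annihilator (R : comNzRingType) (G : category) (s : top_functor G) :
    set (skew_alg R s) :=
  [set a | forall (phi : forall e : G, s e -> R) (c : G) (y : s c),
    module_act a phi y = 0].

Lemma annihilator_ideal (R : comNzRingType) (G : category)
    (s : top_functor G) : ideal (@annihilator R G s).
Proof.
split=> [phi c y|a b a0 b0 phi c y|a b b0].
- by rewrite -(subrr (0 : skew_alg R s)) module_actB subrr.
- by rewrite module_actB a0 b0 subr0.
- split=> phi c y; rewrite module_actM//.
  by apply: fsbig1 => p _; rewrite b0 mulr0.
Qed.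

(** Elements of A act by pointwise multiplication, so acting on the constant family 1 recovers their
    components. *)
Lemma annihilator_diag (R : comNzRingType) (G : category)
    (s : top_functor G) : @annihilator R G s `&` diag_alg R s = [set 0].
Proof.
apply/seteqP; split=> [a [ann aA]|_ ->]; last first.
  split; first by case: (annihilator_ideal R s).
  by apply: diag_algP => n y; rewrite [coef _ _ _](_ : _ = 0).
case: aA ann => f _ <- ann; apply: skew_algP => n; apply/funext => y.
have [nE|nE] := pselect (n = Mor (mid (cod n))).
  rewrite embed_mid//.
  by have := ann (fun _ _ => 1) _ y; rewrite module_act_embed mulr1.
by rewrite embed_notmid.
Qed.

Lemma ideal_intersection_aperiodic (R : comNzRingType) (G : category)
    (s : top_functor G) :
  ideal_intersection (diag_alg R s) -> forall (e : G) (x : s e), ~ periodic x.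
Proof.
move=> idI e x [n n1 nx].
apply: (idI _ (annihilator_ideal R s) _ (annihilator_diag R s)).
pose un := monomial R (x : s (cod (Mor n))).
pose ue := monomial R (x : s (cod (Mor (mid e)))).
(* Away from [x] both monomials act as 0; at [x] they evaluate [phi] at s(n) x and at x, which
   coincide. *)
have ann : annihilator (un - ue).
  move=> phi c y; rewrite module_actB.
  have [E|E] := pselect
    (existT (fun c => s c : Type) c y = existT (fun c => s c : Type) e x).
    have Ec : c = e := congr1 (@tag _ _) E.
    case: _ / (esym Ec) y E => y E.
    rewrite (existT_inj E : y = x) !module_act_monomial nx act_id.
    exact: subrr.
  by rewrite !module_act_monomial0// subr0.
move=> ann0; move: ann; rewrite ann0 => une.
(* The coefficient of the difference at [n] and [x] is 1, since [ue] is supported on the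
   identity. *)
have := congr1 (fun a => coef a (Mor n) x) (une : un - ue = 0).
rewrite [LHS](_ : _ = coef un (Mor n) x - coef ue (Mor n) x)//.
rewrite [in LHS]monomial_id [coef ue _ _](_ : _ = 0).
  by rewrite subr0; apply/eqP; rewrite oner_eq0.
apply: contrapT => /monomial_neq0 /(congr1 (@tag _ _)).
by move=> /Mor_inj.
Qed.

(** * Groupoids without periodic points *)

Lemma groupoid_ideal_intersection (R : comNzRingType) (G : category)
    (s : top_functor G) :
  groupoid G -> (forall (e : G) (x : s e), ~ periodic x) ->
  ideal_intersection (diag_alg R s).
Proof.
move=> grG free I [I0 _ IM] In0 IA.
apply: In0; apply/seteqP; split=> [a Ia|_ ->//].
apply: skew_algP => -[d c n]; apply/funext => x.
apply: contrapT => anx0.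
have [k [kn nk]] := grG _ _ n.
(* With this point, [monomial R z] is delta_(s(n) x) u_(n^-1), where [k] is the inverse of [n]. *)
pose z : s (cod (Mor k)) := act s n x.
pose a' := skew_mul (embed (delta R x)) a.
have a'E (e : G) (m : mhom e c) : coef a' (Mor m) x = coef a (Mor m) x.
  by rewrite skew_mul_embedl /=; case: asboolP => //= _; rewrite mul1r.
pose b := skew_mul a' (monomial R z).
have Ib : I b by exact: (IM _ _ (IM (embed (delta R x)) _ Ia).1).2.
(* A nonzero term has y = x, m' = k and s(m) x = s(n) x. Then mk fixes x, because nk is an identity,
   so aperiodicity makes mk an identity too. *)
have factE (e f g : G) (m : mhom f g) (m' : mhom e f) (y : s g) :
    coef a' (Mor m) y * coef (monomial R z) (Mor m') (act s m y) <> 0 ->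
    existT (fun q => s (cod q) : Type) (Mor (mcomp m m')) y =
      existT (fun q => s (cod q) : Type) (Mor (mid c)) x /\ Mor m' = Mor k.
  move=> h.
  have E : existT (fun c => s c : Type) g y = existT (fun c => s c : Type) c x.
    apply: contrapT => yx; apply: h; rewrite skew_mul_embedl /=.
    by case: asboolP => //= _; rewrite !mul0r.
  have Eg : g = c := congr1 (@tag _ _) E.
  case: _ / (esym Eg) m y E h => m y E; rewrite (existT_inj E : y = x) => h.
  have E2 : existT (fun q => s (cod q) : Type) (Mor m') (act s m x) =
            existT (fun q => s (cod q) : Type) (Mor k) z.
    by apply: (monomial_neq0 (R := R)) => h0; apply: h; rewrite h0 mulr0.
  have Em' : Mor m' = Mor k := congr1 (@tag _ _) E2; split=> //.
  have Ee : e = c := congr1 (@dom G) Em'.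
  have Ef : f = d := congr1 (@cod G) Em'.
  subst e f.
  have mk : m' = k := Mor_inj Em'.
  subst m'.
  have mx : act s m x = act s n x := existT_inj E2.
  suff -> : mcomp m k = mid c by [].
  apply: contrapT => mk1; apply: (free c x); exists (mcomp m k) => //.
  by rewrite act_comp /= mx -[LHS]/((act s k \o act s n) x) -act_comp nk act_id.
have bA : diag_alg R s b.
  apply: diag_algP => -[e g q] y b0.
  have [p pq h] : exists2 p : factors e g, mcomp (fact1 p) (fact2 p) = q &
    coef a' (Mor (fact1 p)) y *
      coef (monomial R z) (Mor (fact2 p)) (act s (fact1 p) y) <> 0.
    apply: contrapT => nex; apply: b0; rewrite skew_mulE.
    by apply: fsbig1 => p pq; apply: contrapT => h; apply: nex; exists p.
  have [/(congr1 (@tag _ _)) /= E _] := factE _ _ _ _ _ _ h.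
  have Eg : g = c := congr1 (@cod G) E.
  by rewrite pq in E; rewrite E Eg.
have : coef b (Mor (mid c)) x = 0.
  have : [set 0] b by rewrite -IA.
  by move=> ->.
(* This factorization contributes a_n(x), and no other contributes: mk = [mid c] and kn = [mid d]
   give m = mkn = n. *)
pose p0 : {classic factors c c} := existT _ d (n, k).
rewrite skew_mulE (fsum_eq1 (i := p0))//.
- rewrite [LHS](_ : _ = coef a' (Mor n) x * coef (monomial R z) (Mor k) z)//.
  by rewrite monomial_id mulr1 a'E.
- case=> [f [m m']] mm' h; have {}mm' : mcomp m m' = mid c := mm'.
  have [_ Em'] := factE _ _ _ m m' x h.
  have Ef : f = d := congr1 (@cod G) Em'.
  subst f; have {}Em' : m' = k := Mor_inj Em'; subst m'.
  suff -> : m = n by [].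
  by rewrite -[m]mcompm1 -kn mcompA mm' mcomp1m.
Qed.

(** * Discrete topological freeness and the cardinality conditions *)

(** Singletons are open, so a dense set of aperiodic points contains every point. *)
Lemma discrete_topologically_freeP (G : category) (s : top_functor G) :
  (forall (e : G) (U : set (s e)), open U) ->
  topologically_free s <-> (forall (e : G) (x : s e), ~ periodic x).
Proof.
move=> s_discrete; split=> [free e x|free e U [x Ux] _].
  have [|_ [-> //]] := free e [set x] _ (s_discrete _ _).
  by exists x.
by exists x; split => //; exact: free.
Qed.

(** Without periodic points, evaluation of the monoid at [x] is injective, making the orbit as large
    as the monoid: if k = lp differs from l and s(k) x = s(l) x, then p is not the identity and
    fixes s(l) x. *)
Lemma divisible_periodic (G : category) (s : top_functor G) (e : G) (x : s e) :
  divisible_at e -> ~ ([set: mhom e e] #<= orbit_at x)%card ->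
  exists y : s e, periodic y.
Proof.
move=> dive ninj; apply: contrapT => noper; apply: ninj.
suff /card_eqPle[] : (orbit_at x #= [set: mhom e e])%card by [].
apply: inj_card_eq => m n _ _ mn.
have step (k l p : mhom e e) : k <> l -> act s k x = act s l x ->
    k = mcomp l p -> False.
  move=> kl klx kE; apply: noper; exists (act s l x); exists p.
    by move=> p1; apply: kl; rewrite kE p1 mcompm1.
  by rewrite -[RHS]klx kE act_comp.
apply: contrapT => mnE; have [p [mE|nE]] := dive _ _ mnE.
  exact: step mnE mn mE.
exact: step (nesym mnE) (esym mn) nE.
Qed.

Theorem theorem24 (R : comNzRingType) (G : category) (s : top_functor G)
    (s_discrete : forall (e : G) (U : set (s e)), open U) :
  (* (a) *)
  (ideal_intersection (diag_alg R s) -> maximal_commutative (diag_alg R s)) /\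
  (* (b) *)
  (groupoid G ->
    (ideal_intersection (diag_alg R s) <-> maximal_commutative (diag_alg R s))) /\
  (* (c) *)
  (GRing.integral_domain_axiom R ->
    (topologically_free s <-> maximal_commutative (diag_alg R s))) /\
  (* (d) *)
  ((exists (e : G) (x : s e),
      card_lt (orbit_at x) [set: mhom e e] /\ divisible_at e) ->
    ~ maximal_commutative (diag_alg R s)) /\
  (* (e) *)
  ((exists (e : G) (x : s e),
      [/\ finite_set (orbit_at x), infinite_set [set: mhom e e]
        & divisible_at e]) ->
    ~ maximal_commutative (diag_alg R s)).
Proof.
have a_imp : ideal_intersection (diag_alg R s) ->
    maximal_commutative (diag_alg R s).
  by move=> /ideal_intersection_aperiodic free; exact/maximal_commutativeP.
split; first exact: a_imp.
split.
  move=> grG; split; first exact: a_imp.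
  by move=> /maximal_commutativeP; exact: groupoid_ideal_intersection.
split.
  by move=> _; rewrite discrete_topologically_freeP// maximal_commutativeP.
split=> -[e [x]].
  move=> [[_ ninj] dive] /maximal_commutativeP free.
  by have [y] := divisible_periodic dive ninj; exact: free.
move=> [orbfin einf dive] /maximal_commutativeP free.
have [|y] := divisible_periodic (x := x) dive; last exact: free.
(* An injection into the finite orbit would make the infinite monoid finite. *)
by move=> /card_le_finite/(_ orbfin).
Qed.
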